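(* Let $A=(a_{ij})$, $1\le i,j\le n$, be a crisp (real) $n\times n$ matrix, and let $b_i=(\underline{b}_i,\overline{b}_i)$, $1\le i\le n$, be fuzzy numbers. Let $B$ be the $n\times n$ matrix containing the positive elements of $A$ and $C$ the $n\times n$ matrix containing the absolute values of the negative elements of $A$, that is, $B_{ij}=\max(a_{ij},0)$ and $C_{ij}=\max(-a_{ij},0)$, so that $A=B-C$. Write $\underline{b}=(\underline{b}_1,\dots,\underline{b}_n)^T$ and $\overline{b}=(\overline{b}_1,\dots,\overline{b}_n)^T$. Then the fuzzy linear system $$\sum_{j=1}^n a_{ij}x_j=b_i,\qquad 1\le i\le n,$$ has a unique strong solution if and only if the following conditions hold: 1) the matrices $A=B-C$ and $B+C$ are both nonsingular; 2) $(B+C)^{-1}(\underline{b}-\overline{b})\le 0$.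
   Context: A fuzzy number in parametric form is a pair $u=(\underline{u},\overline{u})$ of functions $\underline{u}(r),\overline{u}(r)$, $0\le r\le 1$, such that $\underline{u}$ is a bounded monotonically increasing left continuous function on $[0,1]$, $\overline{u}$ is a bounded monotonically decreasing left continuous function on $[0,1]$, and $\underline{u}(r)\le\overline{u}(r)$ for $0\le r\le 1$. A crisp number $a$ is represented by $\underline{u}(r)=\overline{u}(r)=a$, $0\le r\le 1$. Two fuzzy numbers $u,v$ are equal if $\underline{u}(r)=\underline{v}(r)$ and $\overline{u}(r)=\overline{v}(r)$ for all $r\in[0,1]$. Addition is $u+v=(\underline{u}+\underline{v},\overline{u}+\overline{v})$; for real $k>0$, $ku=(k\underline{u},k\overline{u})$; for real $k<0$, $ku=(k\overline{u},k\underline{u})$. A solution of the fuzzy linear system is a vector of fuzzy numbers $(x_1,\dots,x_n)^T$ satisfying the system in the sense of these operations and this equality. The crisp system associated with the fuzzy linear system is the $2n\times 2n$ system $$S\,(\underline{x}_1,\dots,\underline{x}_n,-\overline{x}_1,\dots,-\overline{x}_n)^T=(\underline{b}_1,\dots,\underline{b}_n,-\overline{b}_1,\dots,-\overline{b}_n)^T,\qquad S=\begin{pmatrix} B & C\\ C & B\end{pmatrix},$$ in the unknown functions $\underline{x}_i,\overline{x}_i$ of $r\in[0,1]$. If a solution of the crisp system defines a fuzzy solution of the fuzzy linear system, it is called a strong solution; formally, a solution $(\underline{x}_1,\dots,\underline{x}_n,-\overline{x}_1,\dots,-\overline{x}_n)^T$ of the crisp system is called a strong solution if $\underline{x}_i\le\overline{x}_i$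 for each $1\le i\le n$. Inequalities between vectors are entrywise, and inequalities between functions of $r$ are for all $r\in[0,1]$.
   Formalization: ''Has a unique strong solution'' is taken to mean that the crisp system has exactly one solution and that it is strong; with uniqueness only among strong solutions the ''only if'' part fails, e.g. for A = [1 1; 1 -1], b = 0. *)

(* Defs.v *)
From HB Require Import structures.
From mathcomp Require Import all_boot all_order all_algebra.
From mathcomp Require Import all_classical all_reals all_analysis.

Set Implicit Arguments.
Unset Strict Implicit.
Unset Printing Implicit Defensive.

Import Order.TTheory GRing.Theory Num.Theory.
Import numFieldNormedType.Exports.

Local Open Scope classical_set_scope.
Local Open Scope ring_scope.

(* Functions of r in [0, 1] are represented by functions on R of which only
   the values on [0, 1] matter.  Left continuity at r = 0 is vacuous. *)
Record fuzzy_number (R : realType) := FuzzyNumber {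
  lower : R -> R;
  upper : R -> R;
  lower_bounded : exists M : R, forall r, 0 <= r <= 1 -> `|lower r| <= M;
  upper_bounded : exists M : R, forall r, 0 <= r <= 1 -> `|upper r| <= M;
  lower_increasing :
    forall r s, 0 <= r -> r <= s -> s <= 1 -> lower r <= lower s;
  upper_decreasing :
    forall r s, 0 <= r -> r <= s -> s <= 1 -> upper s <= upper r;
  lower_left_continuous :
    forall r, 0 < r <= 1 -> lower x @[x --> r^'-] --> lower r;
  upper_left_continuous :
    forall r, 0 < r <= 1 -> upper x @[x --> r^'-] --> upper r;
  lower_le_upper : forall r, 0 <= r <= 1 -> lower r <= upper r
}.

Section FuzzyLinearSystem.
Variables (R : realType) (n : nat).
Implicit Types (A : 'M[R]_n) (b : 'I_n -> fuzzy_number R).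

Definition pos_part_mx A : 'M[R]_n := \matrix_(i, j) Num.max (A i j) 0.
Definition neg_part_mx A : 'M[R]_n := \matrix_(i, j) Num.max (- A i j) 0.

Lemma pos_sub_neg_part_mx A : pos_part_mx A - neg_part_mx A = A.
Proof.
apply/matrixP => i j; rewrite !mxE -[in Num.max (- _) _]oppr0 -oppr_min opprK.
by rewrite addr_max_min addr0.
Qed.

Definition lower_vec b (r : R) : 'cV[R]_n := \col_i lower (b i) r.
Definition upper_vec b (r : R) : 'cV[R]_n := \col_i upper (b i) r.

Definition crisp_mx A : 'M[R]_(n + n) :=
  block_mx (pos_part_mx A) (neg_part_mx A)
           (neg_part_mx A) (pos_part_mx A).

(* The unknowns xl, xu are arbitrary vector functions of r in [0, 1]. *)
Definition crisp_solution A b (xl xu : R -> 'cV[R]_n) : Prop :=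
  forall r, 0 <= r <= 1 ->
    crisp_mx A *m col_mx (xl r) (- xu r) =
    col_mx (lower_vec b r) (- upper_vec b r).

Definition strong_solution A b (xl xu : R -> 'cV[R]_n) : Prop :=
  crisp_solution A b xl xu /\
  forall r, 0 <= r <= 1 -> forall i, xl r i 0 <= xu r i 0.

(* The solution is unique and it is strong: uniqueness is among all solutions
   of the crisp system.  Uniqueness among strong solutions only is weaker: for
   A = [1, 1; 1, -1] and b = 0 the zero solution is the only strong one, but
   the crisp matrix is singular. *)
Definition has_unique_strong_solution A b : Prop :=
  exists xl xu, strong_solution A b xl xu /\
    forall yl yu, crisp_solution A b yl yu ->
      forall r, 0 <= r <= 1 -> yl r = xl r /\ yu r = xu r.

End FuzzyLinearSystem.

(* Main.v *)
(* Adding and subtracting the two block rows of the crisp system decouples it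
   into (B + C) (xl - xu) = lb - ub and A (xl + xu) = lb + ub.  Solutions are
   thus unique exactly when both matrices are injective, and a solution is
   strong exactly when xl - xu = (B + C)^-1 (lb - ub) is nonpositive. *)

Require Import Defs.
From HB Require Import structures.
From mathcomp Require Import all_boot all_order all_algebra.
From mathcomp Require Import all_classical all_reals all_analysis.

Set Implicit Arguments.
Unset Strict Implicit.
Unset Printing Implicit Defensive.

Import Order.TTheory GRing.Theory Num.Theory.
Import numFieldNormedType.Exports.

Local Open Scope ring_scope.

(** [kermx] is a left kernel, so the argument passes to the transpose: each row of [kermx M^T],
    transposed, is a column vector killed by [M]. *)
Lemma unitmx_ker_cV (F : fieldType) (n : nat) (M : 'M[F]_n) :
  (forall v : 'cV_n, M *m v = 0 -> v = 0) -> M \in unitmx.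
Proof.
move=> inj_M; rewrite -unitmx_tr -row_free_unit -kermx_eq0.
apply/eqP/row_matrixP => i; rewrite row0; apply: trmx_inj; rewrite trmx0.
apply: inj_M; apply: trmx_inj.
by rewrite trmx_mul trmxK trmx0 -row_mul mulmx_ker row0.
Qed.

(** The sum and difference of [x - y] and [x + y] give [2x] and [2y], and doubling is injective in
    characteristic 0. *)
Lemma sum_diff_inj (F : numFieldType) (V : lmodType F) (x y x' y' : V) :
  x - y = x' - y' -> x + y = x' + y' -> x = x' /\ y = y'.
Proof.
have dbl_inj (z z' : V) : z + z = z' + z' -> z = z'.
  rewrite -(mulr2n z) -(mulr2n z') -(scaler_nat _ z) -(scaler_nat _ z').
  by apply: scalerI; rewrite pnatr_eq0.
have dbl_l (z t : V) : z + z = (z - t) + (z + t) by rewrite addrACA addNr addr0.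
have dbl_r (z t : V) : t + t = (z + t) - (z - t).
  by rewrite opprB [RHS]addrC subrKA.
move=> eqB eqD; split; apply: dbl_inj.
  by rewrite (dbl_l x y) eqB eqD -dbl_l.
by rewrite (dbl_r x y) eqB eqD -dbl_r.
Qed.

(** Nothing is lost in the decoupling: the two block rows can be recovered from their sum and
    difference. *)
Lemma crisp_mx_decouple (R : realType) (n : nat) (A : 'M[R]_n)
    (x y l u : 'cV[R]_n) :
  crisp_mx A *m col_mx x (- y) = col_mx l (- u) <->
  (pos_part_mx A + neg_part_mx A) *m (x - y) = l - u /\ A *m (x + y) = l + u.
Proof.
rewrite /crisp_mx mul_block_col.
set B := pos_part_mx A; set C := neg_part_mx A.
have eqB : (B + C) *m (x - y) = (B *m x + C *m - y) + (C *m x + B *m - y).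
  by rewrite mulmxDl !mulmxDr addrACA [X in _ + X]addrC addrACA.
have eqD : A *m (x + y) = (B *m x + C *m - y) - (C *m x + B *m - y).
  rewrite -{1}(pos_sub_neg_part_mx A) mulmxBl !mulmxDr !mulmxN !opprD opprK.
  by rewrite [- (C *m x) - _]addrC addrACA [B *m y - _]addrC.
rewrite eqB eqD; split=> [/eq_col_mx[-> ->]|[sumE diffE]].
  by rewrite opprK.
(* Reading [l + u] as [l - (- u)] makes it the difference of the two right-hand blocks. *)
move: diffE; rewrite -{1}[u]opprK => diffE.
by have [-> ->] := @sum_diff_inj R _ _ _ _ _ diffE sumE.
Qed.

Theorem theorem3 (R : realType) (n : nat) (A : 'M[R]_n)
    (b : 'I_n -> fuzzy_number R) :
  has_unique_strong_solution A b <->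
  (A \in unitmx /\ pos_part_mx A + neg_part_mx A \in unitmx) /\
  (forall r : R, 0 <= r <= 1 -> forall i : 'I_n,
     (invmx (pos_part_mx A + neg_part_mx A) *m
        (lower_vec b r - upper_vec b r)) i 0 <= 0).
Proof.
split=> [[xl [xu [[sol_x le_x] uniq_x]]]|[[unitA unitBC] le0]].
  have r0 : 0 <= (0 : R) <= 1 by rewrite lexx ler01.
  have unitBC : pos_part_mx A + neg_part_mx A \in unitmx.
    apply: unitmx_ker_cV => v BCv0.
    (* Opposite shifts keep the sum and change the difference by [2v], which [B + C] kills. The
       shifted pair may fail to be strong, but uniqueness covers all crisp solutions. *)
    have sol_v : crisp_solution A b (fun r => xl r + v) (fun r => xu r - v).
      move=> r /sol_x /crisp_mx_decouple[eqB eqD]; apply/crisp_mx_decouple.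
      split; last by rewrite addrACA subrr addr0.
      rewrite opprB [v - _]addrC addrACA [LHS]mulmxDr eqB.
      by rewrite mulmxDr BCv0 !addr0.
    have [/eqP + _] := uniq_x _ _ sol_v 0 r0.
    by rewrite -subr_eq0 addrAC subrr add0r => /eqP.
  split; first split=> //.
    apply: unitmx_ker_cV => v Av0.
    (* Equal shifts keep the difference and change the sum by [2v], which [A] kills. *)
    have sol_v : crisp_solution A b (fun r => xl r + v) (fun r => xu r + v).
      move=> r /sol_x /crisp_mx_decouple[eqB eqD]; apply/crisp_mx_decouple.
      split; first by rewrite opprD addrACA subrr addr0.
      by rewrite addrACA [LHS]mulmxDr eqD mulmxDr Av0 !addr0.
    have [/eqP + _] := uniq_x _ _ sol_v 0 r0.
    by rewrite -subr_eq0 addrAC subrr add0r => /eqP.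
  move=> r r01 i; have /crisp_mx_decouple[<- _] := sol_x r r01.
  by rewrite mulKmx // !mxE subr_le0 le_x.
(* [p] and [q] are the values that the decoupled equations force on [xl + xu] and [xl - xu]; halving
   their sum and difference yields the solution. *)
pose p r := invmx A *m (lower_vec b r + upper_vec b r).
pose q r := invmx (pos_part_mx A + neg_part_mx A) *m
              (lower_vec b r - upper_vec b r).
pose xl r := 2^-1 *: (p r + q r); pose xu r := 2^-1 *: (p r - q r).
have half (V : lmodType R) (z : V) : 2^-1 *: (z + z) = z.
  by rewrite -mulr2n -(scaler_nat _ z) scalerA mulVf ?scale1r ?pnatr_eq0.
have xB r : xl r - xu r = q r.
  by rewrite -scalerBr opprB addrC subrKA half.
have xD r : xl r + xu r = p r.
  by rewrite -scalerDr addrACA subrr addr0 half.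
exists xl, xu; split; first split=> r r01.
- by apply/crisp_mx_decouple; rewrite xB xD !mulKVmx.
- by move=> i; rewrite -subr_le0; have := le0 r r01 i; rewrite -/(q r) -xB !mxE.
move=> yl yu sol_y r r01; have /crisp_mx_decouple[eqB eqD] := sol_y r r01.
(* Any crisp solution has difference [q r] and sum [p r], which determine it. *)
by apply: sum_diff_inj; rewrite ?xB ?xD /q /p -?eqB -?eqD mulKmx.
Qed.
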